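(* Let $1\le k\le n-1$, $I\in\binom{[n]}{k}$, $l=\sigma(I)$, with cyclic data $I_i,S_i,E(S_i)$ ($1\le i\le l$) of $I$ in $[n]$, and cyclic data $\widetilde I_i,\widetilde S_i$ ($1\le i\le\sigma(\mathbf{pad}(I))$) of $\mathbf{pad}(I)$ in $[2n]$, cones $\widetilde\Pi_i$ and projection $\pi:\mathbb R^{2n}\to\mathbb R^n$ onto the first $n$ coordinates. Then the concave extension $\widehat\theta_I$ on $[0,1]^n$ is given as follows. (1) If $\sigma(\mathbf{pad}(I))=\sigma(I)=l$, i.e. $1\in I$ and $n\notin I$: $$\widehat\theta_I(x)=\begin{cases}\sum_{m=1}^{E(S_{i-1})}x_m+|I_i|+\dots+|I_l| & \text{for } x\in\pi(\widetilde\Pi_i)\cap[0,1]^n,\ i\in[2,l],\\ \sum_{m=1}^{E(S_l)}x_m & \text{for } x\in\pi(\widetilde\Pi_1)\cap[0,1]^n.\end{cases}$$ (2) If $\sigma(\mathbf{pad}(I))=\sigma(I)+1=l+1$: (a) if $1\in I$ and $n\in I$, then $$\widehat\theta_I(x)=\begin{cases}\sum_{m=1}^{E(S_{i-1})}x_m+|I_i|+\dots+|I_l|+|\widetilde I_{l+1}| & \text{for } x\in\pi(\widetilde\Pi_i)\cap[0,1]^n,\ i\in[2,l+1],\\ \sum_{m=1}^{n}x_m & \text{for } x\in\pi(\widetilde\Pi_1)\cap[0,1]^n;\end{cases}$$ (b) if $1\notin I$ and $n\in I$, then $$\widehat\theta_I(x)=\begin{cases}\sum_{m=1}^{E(S_{i-1})}x_m+|I_1\setminus[1,E(S_1)]|+|I_i|+\dots+|I_l|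 & \text{for } x\in\pi(\widetilde\Pi_i)\cap[0,1]^n,\ i\in[2,l+1],\\ k & \text{for } x\in\pi(\widetilde\Pi_1)\cap[0,1]^n;\end{cases}$$ (c) if $1\notin I$ and $n\notin I$, then $$\widehat\theta_I(x)=\begin{cases}\sum_{m=1}^{E(S_{i-1})}x_m+|I_i|+\dots+|I_l| & \text{for } x\in\pi(\widetilde\Pi_i)\cap[0,1]^n,\ i\in[2,l+1],\\ k & \text{for } x\in\pi(\widetilde\Pi_1)\cap[0,1]^n.\end{cases}$$ (Empty sums $|I_i|+\dots+|I_l|$ with $i=l+1$ are $0$.)
   Context: Notation: $[n]=\{1,\dots,n\}$, $[a,b]=\{a,\dots,b\}$, $x(S)=\sum_{i\in S}x_i$, $e_J=\sum_{i\in J}e_i$. Schubert matroid: for $k$-subsets $L=\{l_1<\dots<l_k\}$, $I=\{i_1<\dots<i_k\}$ of $[n]$, $L\le_G I$ means $l_r\le i_r$ for all $r$. $\Omega_I$ is the matroid on $[n]$ with bases the $k$-subsets $L\le_G I$; its rank function is $\theta_I(S)=\max\{|S\cap L|:L\text{ a basis}\}$. The concave extension is $\widehat\theta_I(x)=\max\{\sum_J\lambda_J\theta_I(J):\lambda_J\ge0,\sum\lambda_J=1,\sum\lambda_Je_J=x\}$ for $x\in[0,1]^n$. Cyclic data of a nonempty proper subset $I\subset[N]$: let $I=I_1\sqcup\dots\sqcup I_l$ be the unique decomposition into maximal cyclic intervals of $[N]$ in cyclic order, and $\sigma(I)=l$ (the partition number). Let $C_i$ be the cyclic interval between $I_{i-1}$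 and $I_i$ (indices mod $l$), $S_i=(C_i,I_i)$ the cyclic interval consisting of $C_i$ followed by $I_i$, indexed so that $1\in S_1$. $E(S_i)$ is the last element of $S_i$ in cyclic order. Padding: for $I\in\binom{[n]}{k}$, $\mathbf{pad}(I)=I\cup\{n+k+1,n+k+2,\dots,2n\}\in\binom{[2n]}{n}$. The cyclic data of $\mathbf{pad}(I)$ in $[2n]$ are denoted $\widetilde I_i,\widetilde C_i,\widetilde S_i$, $1\le i\le\sigma(\mathbf{pad}(I))=:r$. Cones: for $1\le i\le r$ (indices mod $r$), $\widetilde\Pi_i\subset\mathbb R^{2n}$ is the set of $\widetilde x$ with $\widetilde x([2n])=n$ and $\widetilde x(\widetilde S_i\cup\widetilde S_{i+1}\cup\dots\cup\widetilde S_{i+t})\ge|\widetilde I_i|+|\widetilde I_{i+1}|+\dots+|\widetilde I_{i+t}|$ for $t=0,1,\dots,r-2$. *)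

(* Defs.v *)
From HB Require Import structures.
From mathcomp Require Import all_boot all_order all_algebra.
From mathcomp Require Import reals zify.

Set Implicit Arguments.
Unset Strict Implicit.
Unset Printing Implicit Defensive.

Import Order.TTheory GRing.Theory Num.Theory.
Local Open Scope ring_scope.

(* The ground set [N] = {1, ..., N} is represented by 'I_N, the ordinal i      *)
(* standing for the label i + 1.                                              *)
Definition has_label (N : nat) (A : {set 'I_N}) (m : nat) : bool :=
  [exists i in A, i.+1 == m].

Section Cyclic.
Variable N : nat.

(* Number of cyclic successor steps leading from a to x. *)
Definition cdist (a x : 'I_N) : nat := ((x + (N - a)) %% N)%N.

Definition cyc_itv (a b : 'I_N) : {set 'I_N} :=
  [set x | (cdist a x <= cdist a b)%N].

Definition cyclic_interval (J : {set 'I_N}) : bool :=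
  [exists a, exists b, J == cyc_itv a b].

Definition max_cyclic_interval (I J : {set 'I_N}) : bool :=
  maxset [pred K : {set 'I_N} | cyclic_interval K && (K \subset I)] J.

(* Candidate cyclic data: the i-th block is the cyclic interval from          *)
(* [blk_first i] to [blk_last i]; block indices are 1, ..., sigma and are      *)
(* read modulo sigma.                                                         *)
Record block_data := BlockData {
  sigma : nat;
  blk_first : nat -> 'I_N;
  blk_last : nat -> 'I_N }.

Variable D : block_data.

Definition blkI (i : nat) : {set 'I_N} := cyc_itv (blk_first D i) (blk_last D i).

(* (i + sigma).-1 is the index i - 1 modulo sigma, also for i = 0. *)
Definition blkC (i : nat) : {set 'I_N} :=
  cyc_itv (ordS (blk_last D (i + sigma D).-1%N)) (ord_pred (blk_first D i)).

Definition blkS (i : nat) : {set 'I_N} := blkC i :|: blkI i.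

(* The label of the last element E(S_i) of S_i, i.e. of I_i. *)
Definition endS (i : nat) : nat := (blk_last D i).+1.

(* The conditions [blk_gap] (no element of I lies between two consecutive     *)
(* blocks) and [blk_one] (1 lies in S_1) say that the blocks are listed in    *)
(* cyclic order with the prescribed starting point.                           *)
Record is_cyclic_data (I : {set 'I_N}) : Prop := IsCyclicData {
  sigma_gt0 : (0 < sigma D)%N;
  blk_first_mod : forall i, blk_first D (i + sigma D)%N = blk_first D i;
  blk_last_mod : forall i, blk_last D (i + sigma D)%N = blk_last D i;
  blk_max : forall J : {set 'I_N}, max_cyclic_interval I J <->
    exists2 i, (1 <= i <= sigma D)%N & J = blkI i;
  blk_inj : forall i j, (1 <= i <= sigma D)%N -> (1 <= j <= sigma D)%N ->
    blkI i = blkI j -> i = j;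
  blk_gap : forall i, [disjoint blkC i & I];
  blk_one : has_label (blkS 1) 1 }.

End Cyclic.

Close Scope ring_scope.

(* Every nonempty proper subset has cyclic data. *)
Section Existence.
Variables (N : nat) (I : {set 'I_N}).

Lemma cdistE (a x : 'I_N) :
  cdist a x = if (a <= x)%N then (x - a)%N else (x + N - a)%N.
Proof.
rewrite /cdist; have := ltn_ord a; have := ltn_ord x => hx ha.
case: leqP => h.
  by rewrite (_ : x + (N - a) = x - a + N)%N ?modnDr ?modn_small; lia.
by rewrite modn_small; lia.
Qed.

Lemma ordSE (a : 'I_N) : ordS a = (if (a.+1 == N)%N then 0 else a.+1) :> nat.
Proof.
rewrite /=; case: eqP => [->|h]; first by rewrite modnn.
by rewrite modn_small //; have := ltn_ord a; lia.
Qed.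

Lemma ord_predE (a : 'I_N) :
  ord_pred a = (if (a == 0 :> nat)%N then N.-1 else a.-1) :> nat.
Proof.
rewrite /=; have ha := ltn_ord a; case: eqP => [->|h].
  by rewrite modn_small; lia.
by rewrite (_ : (a + N).-1 = a.-1 + N)%N ?modnDr ?modn_small; lia.
Qed.

Lemma cdistP (a x : 'I_N) :
  ((a <= x)%N /\ (cdist a x + a = x)%N) \/ ((x < a)%N /\ (cdist a x + a = x + N)%N).
Proof.
rewrite cdistE; have := ltn_ord a; have := ltn_ord x; case: ifP => h hx ha; [left|right]; lia.
Qed.

Lemma ordSP (a : 'I_N) :
  (a.+1 = N /\ ordS a = 0 :> nat) \/ (a.+1 < N /\ ordS a = a.+1 :> nat)%N.
Proof. by rewrite ordSE; have := ltn_ord a; case: eqP => h ha; [left|right]; lia. Qed.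

Lemma ord_predP (a : 'I_N) :
  (a = 0 :> nat /\ (ord_pred a).+1 = N :> nat) \/
  (0 < a /\ (ord_pred a).+1 = a :> nat)%N.
Proof.
by rewrite ord_predE; have := ltn_ord a; case: eqP => h ha; [left|right]; lia.
Qed.

Local Ltac fact t := let T := type of t in
  lazymatch goal with H : T |- _ => fail | _ => pose proof t end.
Local Ltac cyc := try subst; 
  repeat match goal with
  | |- context [cdist ?a ?x] => fact (cdistP a x)
  | H : context [cdist ?a ?x] |- _ => fact (cdistP a x)
  end;
  repeat match goal with
  | |- context [@ordS N ?a] => fact (ordSP a)
  | H : context [@ordS N ?a] |- _ => fact (ordSP a)
  | |- context [@ord_pred N ?a] => fact (ord_predP a)
  | H : context [@ord_pred N ?a] |- _ => fact (ord_predP a)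
  end;
  repeat match goal with
  | H : context [nat_of_ord ?a] |- _ => fact (ltn_ord a)
  end;
  repeat match goal with
  | H : is_true (_ \in _) |- _ => clear H
  | H : is_true (_ \notin _) |- _ => clear H
  | H : is_true (_ \subset _) |- _ => clear H
  | H : forall _, _ |- _ => clear H
  end;
  lia.

Lemma cdist_inj a : injective (cdist a : 'I_N -> nat).
Proof. by move=> x y h; apply: val_inj => /=; cyc. Qed.

Definition is_end (e : 'I_N) := (e \in I) && (ordS e \notin I).
Definition is_first (e a : 'I_N) := (cyc_itv a e \subset I) && (ord_pred a \notin I).

Lemma exit_fwd s b y : y \in I -> b \notin I -> (cdist s y <= cdist s b)%N ->
  exists2 g, is_end g & (cdist s y <= cdist s g < cdist s b)%N.
Proof.
move=> yI bI; move: {2}(cdist s b - cdist s y)%N (leqnn (cdist s b - cdist s y)%N) => m.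
elim: m y yI => [|m IH] y yI hm hle.
  have eyb : y = b by apply: (@cdist_inj s); lia.
  by rewrite -eyb yI in bI.
have nyb : y <> b by move=> eyb; rewrite -eyb yI in bI.
have lt : (cdist s y < cdist s b)%N.
  by rewrite ltn_neqAle hle andbT; apply/eqP => /cdist_inj.
have eS : cdist s (ordS y) = (cdist s y).+1 by cyc.
case: (boolP (ordS y \in I)) => SyI; last first.
  by exists y; rewrite /is_end ?yI // leqnn.
have [||g ge /andP[h1 h2]] := IH _ SyI; try lia.
by exists g => //; lia.
Qed.

Lemma exit_bwd b e : e \in I -> b \notin I -> exists a, is_first e a.
Proof.
move=> eI bI.
have [j] : exists j, [exists a, (cdist a e == j) && (ord_pred a \notin I)].
  exists (cdist (ordS b) e); apply/existsP; exists (ordS b).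
  by rewrite eqxx ordSK.
move=> hj; pose P := (fun j => [exists a, (cdist a e == j) && (ord_pred a \notin I)]).
case: (ex_minnP (ex_intro P j hj)) => m /existsP[a /andP[/eqP ha na]] hmin.
exists a; rewrite /is_first na andbT; apply/subsetP => x; rewrite inE => hx.
case: (boolP (x \in I)) => // xI.
have nxe : x <> e by move=> exe; rewrite exe eI in xI.
have h : (m <= cdist (ordS x) e)%N.
  by apply: hmin; apply/existsP; exists (ordS x); rewrite eqxx ordSK.
have nv : (x <> e :> nat) by move=> /val_inj.
by cyc.
Qed.

Lemma arc_max a e : is_first e a -> is_end e ->
  max_cyclic_interval I (cyc_itv a e).
Proof.
move=> /andP[sub na] /andP[eI ne]; apply/maxsetP; split=> /=.
  by rewrite sub andbT; apply/existsP; exists a; apply/existsP; exists e.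
move=> B /andP[/existsP[c /existsP[d /eqP->]] subB] sAB.
have ac : a \in cyc_itv c d by apply: (subsetP sAB); rewrite inE; cyc.
have ec : e \in cyc_itv c d by apply: (subsetP sAB); rewrite inE.
rewrite !inE in ac ec.
have eac : a = c.
  apply/eqP; apply: contraNT na => /eqP nac; apply: (subsetP subB).
  have nv : (a <> c :> nat) by move=> /val_inj.
  by rewrite inE; cyc.
rewrite {}eac in ac ec *.
have -> // : e = d.
apply/eqP; apply: contraNT ne => /eqP ned; apply: (subsetP subB).
have nv : (e <> d :> nat) by move=> /val_inj.
by rewrite inE; cyc.
Qed.

Lemma max_arc J : I != setT -> max_cyclic_interval I J ->
  exists a e, [/\ J = cyc_itv a e, is_first e a & is_end e].
Proof.
move=> IT /maxsetP[/= /andP[/existsP[a /existsP[e /eqP->]] sub] hmax].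
have lt : ((cdist a e).+1 < N)%N.
  rewrite ltnNge; apply/negP => h; case/negP: IT; rewrite -subTset.
  apply: subset_trans sub; apply/subsetP => x _; rewrite inE.
  by cyc.
have eI : e \in I by apply: (subsetP sub); rewrite inE.
exists a, e; split=> //; rewrite /is_first /is_end ?sub ?eI /=.
  apply/negP => paI.
  have : ord_pred a \in cyc_itv a e.
    rewrite -(hmax (cyc_itv (ord_pred a) e)).
    - by rewrite inE; cyc.
    - apply/andP; split; first by apply/existsP; exists (ord_pred a); apply/existsP; exists e.
      apply/subsetP => x; rewrite inE => hx.
      have [->//|nxa] := eqVneq x (ord_pred a).
      apply: (subsetP sub); rewrite inE.
      have nv : (x <> ord_pred a :> nat) by move=> /val_inj/eqP; rewrite (negPf nxa).
      by cyc.
    by apply/subsetP => x; rewrite !inE => hx; cyc.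
  by rewrite inE; cyc.
apply/negP => SeI.
have : ordS e \in cyc_itv a e.
  rewrite -(hmax (cyc_itv a (ordS e))).
  - by rewrite inE.
  - apply/andP; split; first by apply/existsP; exists a; apply/existsP; exists (ordS e).
    apply/subsetP => x; rewrite inE => hx.
    have [->//|nxa] := eqVneq x (ordS e).
    apply: (subsetP sub); rewrite inE.
    have nv : (x <> ordS e :> nat) by move=> /val_inj/eqP; rewrite (negPf nxa).
    by cyc.
  by apply/subsetP => x; rewrite !inE => hx; cyc.
by rewrite inE; cyc.
Qed.

Lemma first_uniq e a b : is_first e a -> is_first e b -> a = b.
Proof.
move=> /andP[sa na] /andP[sb nb]; apply/eqP; apply/negPn/negP => /eqP nab.
have nv : (a <> b :> nat) by move=> /val_inj.
case: (leqP (cdist a e) (cdist b e)) => h.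
  by case/negP: na; apply: (subsetP sb); rewrite inE; cyc.
by case/negP: nb; apply: (subsetP sa); rewrite inE; cyc.
Qed.

Lemma end_uniq a b e f : is_end e -> is_end f -> is_first f b -> is_first e a ->
  cyc_itv a e = cyc_itv b f -> e = f.
Proof.
move=> /andP[eI ne] _ /andP[sb _] _ E.
have : e \in cyc_itv b f by rewrite -E inE.
rewrite inE => h; apply/eqP; apply: contraNT ne => /eqP nef.
have nv : (e <> f :> nat) by move=> /val_inj.
by apply: (subsetP sb); rewrite inE; cyc.
Qed.

Lemma cyclic_data_exists : I != set0 -> I != setT ->
  exists D : block_data N, is_cyclic_data D I.
Proof.
move=> /set0Pn[y yI] IT.
have [b bI] : exists b, b \notin I.
  by apply/existsP; move: IT; apply: contraNT; rewrite negb_exists => /forallP h;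
     apply/eqP/setP => x; rewrite inE; move: (h x); rewrite negbK.
pose es := [seq e <- enum 'I_N | is_end e].
have mem_es e : (e \in es) = is_end e by rewrite mem_filter mem_enum andbT.
have es_uniq : uniq es by rewrite filter_uniq ?enum_uniq.
have es_sorted : sorted (fun i j : 'I_N => (i < j)%N) es.
  apply: sorted_filter; first by move=> ? ? ?; apply: ltn_trans.
  by have := iota_ltn_sorted 0 N; rewrite -val_enum_ord sorted_map.
have s_gt0 : (0 < size es)%N.
  have [|g ge _] := @exit_fwd y b y yI bI; first by cyc.
  by rewrite -mem_es in ge; case: (es) ge.
pose fst_of e := odflt e [pick a | is_first e a].
have fst_ofP e : is_end e -> is_first e (fst_of e).
  move=> /andP[eI _]; rewrite /fst_of; case: pickP => // h.
  by have [a ha] := exit_bwd eI bI; rewrite h in ha.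
pose lst i := nth y es ((i + (size es).-1) %% size es)%N.
have lstP i : is_end (lst i) by rewrite -mem_es mem_nth // ltn_pmod.
pose D := BlockData (size es) (fun i => fst_of (lst i)) lst.
have lstD i : lst (i + size es)%N = lst i.
  by rewrite /lst addnAC modnDr.
have lt_nth i j : (i < j < size es)%N -> (nth y es i < nth y es j)%N.
  move=> /andP[ij js].
  by apply: (sorted_ltn_nth _ _ es_sorted) => //;
    [move=> ? ? ?; apply: ltn_trans | rewrite inE; lia].
have le_nth i j : (i <= j < size es)%N -> (nth y es i <= nth y es j)%N.
  rewrite leq_eqVlt => /andP[/orP[/eqP->//|ij] js].
  by apply/ltnW/lt_nth; rewrite ij.
have small i : (1 <= i <= size es)%N -> ((i + (size es).-1) %% size es = i.-1)%N.
  move=> h; rewrite (_ : i + (size es).-1 = i.-1 + size es)%N; last by lia.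
  by rewrite modnDr modn_small; lia.
(* no end lies strictly between two consecutive ends *)
have consec i g : is_end g ->
  (cdist (ordS (lst (i + size es).-1)) (lst i) <= cdist (ordS (lst (i + size es).-1)) g)%N.
  rewrite -mem_es => /(nthP y)[q qs <-]; have {}qs : (q < size es)%N by exact: qs.
  rewrite /lst.
  have -> : ((i + size es).-1 + (size es).-1)%N = (i + (size es).-1 + (size es).-1)%N by lia.
  rewrite -[X in nth y es X](modnDml).
  set p := ((i + (size es).-1) %% size es)%N.
  have ps : (p < size es)%N by rewrite ltn_pmod.
  case: (posnP p) => [->|p0].
    rewrite add0n modn_small; last by lia.
    have h1 : (nth y es 0 <= nth y es q)%N by apply: le_nth; lia.
    have h2 : (nth y es q <= nth y es (size es).-1)%N by apply: le_nth; lia.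
    move: (nth y es 0) (nth y es q) (nth y es _.-1) h1 h2 => u v w h1 h2.
    by cyc.
  rewrite (_ : p + (size es).-1 = p.-1 + size es)%N; last by lia.
  rewrite modnDr modn_small; last by lia.
  have h : (nth y es p.-1 < nth y es p)%N by apply: lt_nth; lia.
  case: (ltnP q p) => hq.
    have h1 : (nth y es q <= nth y es p.-1)%N by apply: le_nth; lia.
    move: (nth y es p) (nth y es q) (nth y es _.-1) h h1 => u v w h1 h2.
    by cyc.
  have h1 : (nth y es p <= nth y es q)%N by apply: le_nth; lia.
  move: (nth y es p) (nth y es q) (nth y es _.-1) h h1 => u v w h1 h2.
  by cyc.
have apart i (s := ordS (lst (i + size es).-1)) (e := lst i) (a := fst_of e) :
    (cdist s e = cdist s a + cdist a e)%N /\ s <> a :> nat.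
  have sI : s \notin I by case/andP: (lstP (i + size es).-1).
  have /andP[sub _] := fst_ofP _ (lstP i); rewrite -/e -/a in sub.
  have : s \notin cyc_itv a e by apply: contra sI; apply: (subsetP sub).
  rewrite inE -ltnNge => h; clearbody s a e; split; first by cyc.
  by move=> /val_inj esa; subst; cyc.
exists D; split=> //=.
- by move=> i; rewrite lstD.
- move=> J; split.
    move=> /(max_arc IT)[a [e [-> fa ee]]].
    have /(nthP y)[q qs qe] : e \in es by rewrite mem_es.
    exists q.+1; first exact: qs.
    have el : lst q.+1 = e by rewrite /lst small.
    by rewrite /blkI /= el (first_uniq fa (fst_ofP _ ee)).
  by move=> [i _ ->]; apply: arc_max => //; apply: fst_ofP.
- move=> i j hi hj E.
  have : lst i = lst j by apply: end_uniq E => //; apply: fst_ofP.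
  have hi' : (i.-1 < size es)%N by lia.
  have hj' : (j.-1 < size es)%N by lia.
  by rewrite /lst !small // => /eqP; rewrite nth_uniq // => /eqP; lia.
- move=> i; rewrite disjoint_subset; apply/subsetP => z.
  rewrite /blkC /= !inE => hz; apply/negP => zI.
  have [e1 e2] := apart i; have cs := consec i.
  have /andP[_ pa] := fst_ofP _ (lstP i).
  have [g ge hg] := exit_fwd zI pa hz.
  have {cs} := cs g ge.
  move: (lst i) (fst_of _) (ordS (lst _)) e1 e2 hg {hz pa ge} => e a s e1 e2 hg h.
  by cyc.
have N0 : (0 < N)%N by have := ltn_ord y; lia.
apply/existsP; exists (Ordinal N0) => /=; rewrite andbT.
rewrite /blkS /blkC /blkI /= !inE.
have := apart 1%N; rewrite add1n /= => -[].
have le : (lst 1 <= lst (size es))%N.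
  by rewrite /lst !small ?leqnn ?s_gt0 //=; apply: le_nth; lia.
move: (lst (size es)) (lst 1) (fst_of _) le => p e a le.
case: leqP => //= h1 h2 h3.
have e0 : Ordinal N0 = 0%N :> nat by [].
by move: (Ordinal N0) e0 h1 => o e0 h1; cyc.
Qed.
End Existence.

Local Open Scope ring_scope.

Section Schubert.
Variable n : nat.
Implicit Types (I L S : {set 'I_n}).

(* [enum] lists a set of ordinals in increasing order, and [all2] is false on *)
(* lists of different lengths.                                                *)
Definition gale_le (L I : {set 'I_n}) : bool :=
  all2 (fun l i : 'I_n => (l <= i)%N) (enum L) (enum I).

Definition schubert_rank (I S : {set 'I_n}) : nat :=
  \max_(L : {set 'I_n} | gale_le L I) #|S :&: L|.

Definition pad (I : {set 'I_n}) : {set 'I_(n + n)} :=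
  (@lshift n n @: I) :|: (@rshift n n @: [set j : 'I_n | (#|I| <= j)%N]).

End Schubert.

Section Vectors.
Variable R : realType.

Definition indicator (n : nat) (J : {set 'I_n}) : 'rV[R]_n :=
  \row_i (i \in J)%:R.

Definition coord_sum (n : nat) (x : 'rV[R]_n) (S : {set 'I_n}) : R :=
  \sum_(i in S) x 0 i.

(* x_1 + ... + x_m *)
Definition prefix_sum (n : nat) (x : 'rV[R]_n) (m : nat) : R :=
  \sum_(i < n | (i < m)%N) x 0 i.

Definition in_cube (n : nat) (x : 'rV[R]_n) : Prop :=
  forall j, 0 <= x 0 j <= 1.

Definition convex_rep (n : nat) (x : 'rV[R]_n) (lam : {set 'I_n} -> R) : Prop :=
  [/\ forall J, 0 <= lam J,
      \sum_(J : {set 'I_n}) lam J = 1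
    & \sum_(J : {set 'I_n}) lam J *: indicator J = x].

(* v is the maximum defining the concave extension of f at x. *)
Definition concave_ext (n : nat) (f : {set 'I_n} -> nat) (x : 'rV[R]_n)
    (v : R) : Prop :=
  (exists2 lam, convex_rep x lam &
     \sum_(J : {set 'I_n}) lam J * (f J)%:R = v) /\
  (forall lam, convex_rep x lam ->
     \sum_(J : {set 'I_n}) lam J * (f J)%:R <= v).

(* The cone tilde Pi_i, for block data D of a padded set. *)
Definition cone (n : nat) (D : block_data (n + n)) (i : nat)
    (x : 'rV[R]_(n + n)) : Prop :=
  coord_sum x [set: 'I_(n + n)] = n%:R /\
  (forall t : nat, (t.+2 <= sigma D)%N ->
     (\sum_(s < t.+1) #|blkI D (i + s)%N|)%:R
       <= coord_sum x (\bigcup_(s < t.+1) blkS D (i + s)%N)).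

Definition proj_cone (n : nat) (D : block_data (n + n)) (i : nat)
    (x : 'rV[R]_n) : Prop :=
  exists2 y : 'rV[R]_(n + n), cone D i y & lsubmx y = x.

End Vectors.

(* Main.v *)
(* The rank of J in the Schubert matroid is the minimum over 0 <= m <= n of     *)
(* #(J in [1, m]) + #(I in [m+1, n]), so F_m(x) = x_1 + ... + x_m +             *)
(* #(I in [m+1, n]) bounds the concave extension from above for every m.  When  *)
(* F_m(x) is the least of these values, systematic sampling attains it: for t   *)
(* in [0, 1] let J_t be the set of steps at which j |-> floor(X_j - X_m + t)    *)
(* jumps, X_j being the j-th partial sum of x.  The average of e_(J_t) over t   *)
(* is x, and every inequality X_j - X_m >= c with c an integer passes from x to *)
(* J_t, so F_m is also least at every J_t.                                      *)
(* On the other side, F decreases along I and increases off I, so its minimum   *)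
(* over m is attained at the last element of a block of pad(I), the position 2n *)
(* counting as 0; the inequalities defining the cone Pi_i telescope to the      *)
(* statement that F is minimal at the end of S_(i-1).                           *)

Require Import Defs.
From HB Require Import structures.
From mathcomp Require Import all_boot all_order all_algebra.
From mathcomp Require Import reals.
From mathcomp Require Import zify lra.
Set Implicit Arguments.
Unset Strict Implicit.
Unset Printing Implicit Defensive.
Import Order.TTheory GRing.Theory Num.Theory.
Local Open Scope ring_scope.

(** * Rank of a Schubert matroid *)

(** Write $F_m(x)$ for [cut_bound I x m]. At $e_J$ the minimum of $F_m$ over $m$ is the rank of $J$
    ([schubert_rank_le], [schubert_rank_ge]), and each $F_m$ is affine in $x$, so each bounds the
    concave extension from above. For equality at a minimising $m$ one needs $x$ as a convex
    combination of sets at all of which the same $m$ is minimal. [systematic_sampling] and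
    [sampled_prefix_ge] provide it, since $F_j\ge F_m$ bounds a difference of partial sums by an
    integer. The result is [concave_ext_cut_bound].

    For the cones, subtract the indicator of $\mathbf{pad}(I)$ from a point with total $n$. The
    total becomes 0, so partial sums $W$ form a potential on the circle, and the inequalities of
    $\widetilde\Pi_{i+1}$ say that $W$ is least at the end of block $i$ ([block_sums_ge]). At block
    ends $W$ is $F-k$ ([pad_prefix_sum]), so the projected cone is the region where that end
    minimises $F$ among block ends ([proj_coneP]); by [cut_bound_min] no other cut does better. The
    explicit formulas follow by comparing the ends of $I$ and $\mathbf{pad}(I)$ ([end_seq_pad]) and
    writing suffix counts of $I$ as sums of block sizes ([sum_card_blkI]). *)

Definition prefix (n m : nat) : {set 'I_n} := [set i : 'I_n | (i < m)%N].
Definition suffix (n m : nat) : {set 'I_n} := [set i : 'I_n | (m <= i)%N].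

Lemma suffix0 (n : nat) : suffix n 0 = setT.
Proof. by apply/setP=> i; rewrite !inE. Qed.

Lemma suffix_out (n m : nat) : (n <= m)%N -> suffix n m = set0.
Proof. by move=> nm; apply/setP=> i; rewrite !inE; have := ltn_ord i; lia. Qed.

Lemma card_prefix_suffix (n m : nat) (A : {set 'I_n}) :
  (#|A :&: prefix n m| + #|A :&: suffix n m| = #|A|)%N.
Proof.
rewrite -(cardsID (prefix n m) A); congr (_ + _)%N; apply: eq_card => i.
by rewrite !inE -leqNgt andbC.
Qed.

(** Taking the head of [s] as threshold counts all of [s], so all of the equally long [t] must be
    counted too; this compares the heads. *)
Lemma all2_leq_count (s t : seq nat) : sorted leq s -> sorted leq t ->
  all2 leq s t <->
  size s = size t /\ forall m, (count (leq m) s <= count (leq m) t)%N.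
Proof.
elim: s t => [|a s IH] [|b t] /=; try by split=> // -[].
move=> ss st.
have as_ : all (leq a) s by apply: order_path_min ss; apply: leq_trans.
have bt_ : all (leq b) t by apply: order_path_min st; apply: leq_trans.
have {IH} := IH t (path_sorted ss) (path_sorted st).
move=> IH; split=> [/andP[ab /IH[-> H]]|[[sz] H]].
  split=> // m; have := H m; case: (leqP m a) => ma; case: (leqP m b) => mb; lia.
have ab : (a <= b)%N.
  have := H a; move: as_; rewrite leqnn all_count => /eqP ->; rewrite sz.
  have := count_size (leq a) t; case: (leqP a b) => //; lia.
rewrite ab /=; apply/IH; split=> // m; have := H m.
case: (leqP m b) => mb; last by have -> : (m <= a)%N = false by lia.
rewrite [X in (_ <= X)%N -> _](_ : _ = (1 + size t)%N); last first.
  by congr (_ + _)%N; apply/eqP; rewrite -all_count; apply: sub_all bt_ => z; lia.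
have /eqP -> : count (leq m) t == size t.
  by rewrite -all_count; apply: sub_all bt_ => z; lia.
by rewrite -sz count_size.
Qed.

Lemma card_suffixE (n m : nat) (A : {set 'I_n}) :
  #|A :&: suffix n m| = count (leq m) (map val (enum A)).
Proof.
rewrite count_map cardE -!size_filter /enum_mem -filter_predI.
by congr size; apply: eq_filter => i; rewrite /= !inE andbC.
Qed.

Lemma gale_leP (n : nat) (L I : {set 'I_n}) : gale_le L I <->
  #|L| = #|I| /\ forall m, (#|L :&: suffix n m| <= #|I :&: suffix n m|)%N.
Proof.
have srt (A : {set 'I_n}) : sorted leq (map val (enum A)).
  rewrite sorted_map; apply: sorted_filter; first by move=> ? ? ?; apply: leq_trans.
  by rewrite -enumT -sorted_map val_enum_ord iota_sorted.
have -> : gale_le L I = all2 leq (map val (enum L)) (map val (enum I)).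
  by rewrite /gale_le; elim: (enum L) (enum I) => [|a s IH] [|b t] //=; rewrite IH.
rewrite (all2_leq_count (srt _) (srt _)) !size_map -!cardE.
by split=> -[-> H]; split=> // m; have := H m; rewrite !card_suffixE.
Qed.

(** By [suffix_bounded_extend] and [gale_leP] these are the independent sets of the Schubert
    matroid. *)
Definition suffix_bounded (n : nat) (I A : {set 'I_n}) :=
  [forall m : 'I_n.+1, (#|A :&: suffix n m| <= #|I :&: suffix n m|)%N].

Lemma suffix_boundedP (n : nat) (I A : {set 'I_n}) :
  reflect (forall m, (#|A :&: suffix n m| <= #|I :&: suffix n m|)%N)
    (suffix_bounded I A).
Proof.
apply: (iffP forallP) => [H m|H m]; last exact: H.
case: (ltnP m n.+1) => mn; first exact: (H (Ordinal mn)).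
by rewrite suffix_out ?setI0 ?cards0 // ltnW.
Qed.

Lemma suffixU1 (n m : nat) (p : 'I_n) (A : {set 'I_n}) : p \notin A ->
  #|(p |: A) :&: suffix n m| = ((m <= p) + #|A :&: suffix n m|)%N.
Proof.
move=> pA; rewrite setIUl; case: leqP => mp.
  rewrite (_ : [set p] :&: _ = [set p]) ?cardsU1 ?inE ?(negPf pA) //.
  by apply/setP=> i; rewrite !inE; case: eqP => // ->.
rewrite (_ : [set p] :&: _ = set0) ?set0U //.
by apply/setP=> i; rewrite !inE; case: eqP => // ->; lia.
Qed.

(* Adding the least missing element keeps every suffix count admissible: a    *)
(* suffix that sees it has a complement that is already full.                 *)
Lemma suffix_bounded_extend (n : nat) (I A : {set 'I_n}) :
  suffix_bounded I A -> exists2 L : {set 'I_n}, A \subset L & gale_le L I.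
Proof.
move: {2}(#|I| - #|A|)%N (leqnn (#|I| - #|A|)%N) => d.
elim: d A => [|d IH] A hd /suffix_boundedP H.
  have := H 0%N; rewrite suffix0 !setIT => AI.
  by exists A => //; apply/gale_leP; split=> //; lia.
case: (leqP #|I| #|A|) => AI; first by apply: IH; [lia|apply/suffix_boundedP].
have [q qA] : exists q, q \notin A.
  apply/existsP; rewrite -negb_forall; apply/negP => /forallP AT.
  have : (#|I| <= #|A|)%N by apply: subset_leq_card; apply/subsetP.
  lia.
case: (@arg_minnP _ q [pred p | p \notin A] (@nat_of_ord n) qA) => p /= pA pmin.
have [||L sL gL] := IH (p |: A).
- by rewrite cardsU1 pA; lia.
- apply/suffix_boundedP => m; rewrite suffixU1 //.
  case: (leqP m p) => [mp|_]; last exact: H.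
  have := card_prefix_suffix m A; have := card_prefix_suffix m I.
  have -> : A :&: prefix n m = prefix n m.
    apply/setIidPr/subsetP => i; rewrite inE => im.
    by apply: contraLR im => /pmin; lia.
  have : (#|I :&: prefix n m| <= #|prefix n m|)%N.
    by apply: subset_leq_card; apply: subsetIr.
  lia.
exists L => //; apply: subset_trans sL; exact: subsetUr.
Qed.

(** Split a basis at $m$: the lower part is counted inside $S$, the upper part is bounded by the
    Gale comparison. *)
Lemma schubert_rank_le (n m : nat) (I S : {set 'I_n}) :
  (schubert_rank I S <= #|S :&: prefix n m| + #|I :&: suffix n m|)%N.
Proof.
apply/bigmax_leqP => L /gale_leP[_ H].
rewrite -(card_prefix_suffix m (S :&: L)); apply: leq_add.
  by apply: subset_leq_card; apply: setSI; apply: subsetIl.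
apply: leq_trans (H m); apply: subset_leq_card; apply: setSI; exact: subsetIr.
Qed.

(* The minimum is attained at the first suffix that a largest independent     *)
(* subset of S saturates.                                                     *)
Lemma schubert_rank_ge (n : nat) (I S : {set 'I_n}) : exists2 m, (m <= n)%N &
  (#|S :&: prefix n m| + #|I :&: suffix n m| <= schubert_rank I S)%N.
Proof.
pose P (A : {set 'I_n}) := (A \subset S) && suffix_bounded I A.
have P0 : P set0.
  by rewrite /P sub0set; apply/suffix_boundedP => m; rewrite set0I cards0.
case: (@arg_maxnP _ set0 P (fun A : {set 'I_n} => #|A|) P0) => A /andP[AS Ab] Amax.
have [L AL gL] := suffix_bounded_extend Ab.
have rk : (#|A| <= schubert_rank I S)%N.
  apply: (@bigop.bigmax_sup _ L) => //; apply: subset_leq_card.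
  by rewrite subsetI AS.
pose tight m := #|A :&: suffix n m| == #|I :&: suffix n m|.
have tn : tight n.
  by rewrite /tight suffix_out ?setI0.
case: (ex_minnP (ex_intro _ n tn)) => m /eqP tm mmin.
exists m; first exact: mmin.
apply: leq_trans rk; rewrite -tm -(card_prefix_suffix m A) leq_add2r.
apply: subset_leq_card; apply/subsetP => p /setIP[pS]; rewrite !inE => pm.
rewrite pm andbT; case: (boolP (p \in A)) => // pA.
(* A suffix containing [p] starts before the least tight one, hence has room for one more element;
   adding [p] would contradict maximality. *)
suff /Amax : P (p |: A) by rewrite cardsU1 pA; lia.
rewrite /P subUset sub1set pS AS; apply/suffix_boundedP => j.
rewrite suffixU1 //; have /suffix_boundedP /(_ j) := Ab.
case: (leqP j p) => // jp; have := mmin j; rewrite /tight; lia.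
Qed.

(** * Concave extension *)

Lemma prefix_sumS (R : realType) (n : nat) (x : 'rV[R]_n) (i : 'I_n) :
  prefix_sum x i.+1 = prefix_sum x i + x 0 i.
Proof.
rewrite /prefix_sum (bigD1 i) //= addrC; congr (_ + _).
by apply: eq_bigl => j; rewrite ltnS -val_eqE /=; case: ltngtP.
Qed.

Lemma prefix_sum0 (R : realType) (n : nat) (x : 'rV[R]_n) : prefix_sum x 0 = 0.
Proof. by rewrite /prefix_sum big_pred0. Qed.

Lemma prefix_sum_indicator (R : realType) (n m : nat) (J : {set 'I_n}) :
  prefix_sum (indicator R J) m = #|J :&: prefix n m|%:R.
Proof.
rewrite /prefix_sum; under eq_bigr do rewrite mxE.
rewrite -natr_sum; congr (_%:R); rewrite -sum1_card [RHS]big_mkcond [LHS]big_mkcond /=.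
by apply: eq_bigr => i _; rewrite !inE andbC; do 2 case: ifP => //; case: (i \in J).
Qed.

(** A left Riemann sum of the step function $[c\le t]$, exact because the jump [c] is one of the
    nodes. *)
Lemma sum_gaps_above (R : realType) (s : seq R) (c : R) :
    sorted <=%R s -> c \in s ->
  \sum_(i < (size s).-1) (s`_i.+1 - s`_i) * (c <= s`_i)%R%:R = s`_(size s).-1 - c.
Proof.
move=> ss cs; have [q qs qc] := nthP 0 cs; have {}qs : (q < size s)%N := qs.
have mono i j : (i <= j < size s)%N -> s`_i <= s`_j.
  by move=> /andP[ij js]; apply: le_sorted_leq_nth; rewrite ?inE ?(leq_ltn_trans ij).
rewrite -(big_mkord xpredT (fun i => (s`_i.+1 - s`_i) * (c <= s`_i)%R%:R)).
rewrite (big_cat_nat (n := q)) //=; last by rewrite -ltnS prednK // (leq_ltn_trans _ qs).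
rewrite big_nat big1 ?add0r => [|i /andP[_ iq]]; last first.
  case: (leP c) => ci; rewrite ?mulr0 // mulr1.
  have := mono i i.+1; have := mono i.+1 q; rewrite qc.
  move=> h1 h2; have {h1} := h1 ltac:(lia); have {h2} := h2 ltac:(lia); lra.
rewrite -qc -telescope_sumr; last by lia.
rewrite !big_nat; apply: eq_bigr => i hi; rewrite mono ?mulr1 //; lia.
Qed.

Lemma floorD_frac (R : realType) (z t : R) : 0 <= t <= 1 ->
  (Num.floor (z + t))%:~R =
  (Num.floor z)%:~R + (1 - (z - (Num.floor z)%:~R) <= t)%R%:R :> R.
Proof.
move=> ht; have := floor_itv z; rewrite intrD mulr1z => hz.
rewrite (@floor_def _ _ (Num.floor z + (1 - (z - (Num.floor z)%:~R) <= t)%R%:R)).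
  by rewrite intrD; case: (leP _ t).
by case: (leP _ t) => h; rewrite !intrD ?mulr1z ?mulr0z; lra.
Qed.

(** * Systematic sampling *)

Section Rounding.
Variables (R : realType) (n : nat) (x : 'rV[R]_n) (m : nat).
Hypotheses (x_cube : in_cube x) (mn : (m <= n)%N).

(** Centring at [m] makes [Z m] vanish, which puts 1 among the breakpoints below. *)
Let Z (j : nat) : R := prefix_sum x j - prefix_sum x m.
Let level (t : R) (j : nat) : int := Num.floor (Z j + t).

(** As the coordinates of [x] lie in $[0,1]$, the level rises by 0 or 1 at each step, so this set
    records all of its increase. *)
Definition sampled (t : R) : {set 'I_n} := [set i : 'I_n | level t i < level t i.+1].

Lemma sampledE (t : R) (i : 'I_n) :
  (i \in sampled t)%:R = (level t i.+1)%:~R - (level t i)%:~R :> R.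
Proof.
rewrite inE.
have hx := x_cube i.
have h1 := floor_itv (Z i + t); have h2 := floor_itv (Z i.+1 + t).
have eZ : Z i.+1 = Z i + x 0 i by rewrite /Z prefix_sumS; lra.
have le1 : level t i <= level t i.+1 by apply: le_floor; rewrite eZ; lra.
have le2 : level t i.+1 < level t i + 2.
  rewrite -(ltr_int R) intrD; rewrite !intrD !mulr1z in h1 h2; rewrite /level; lra.
have [e|e] : level t i.+1 = level t i \/ level t i.+1 = level t i + 1 by lia.
  by rewrite e ltxx subrr.
by rewrite e ltrDl intrD mulr1z addrAC subrr add0r.
Qed.

Lemma prefix_sampled (t : R) (j : nat) : (j <= n)%N ->
  prefix_sum (indicator R (sampled t)) j = (level t j)%:~R - (level t 0)%:~R.
Proof.
elim: j => [|j IH] jn; first by rewrite prefix_sum0 subrr.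
rewrite (@prefix_sumS _ _ _ (Ordinal jn)) /= IH; last by lia.
by rewrite mxE sampledE /=; lra.
Qed.

Lemma sampled_prefix_ge (t : R) (j : nat) (c : int) : (j <= n)%N ->
  prefix_sum x m + c%:~R <= prefix_sum x j ->
  prefix_sum (indicator R (sampled t)) m + c%:~R
    <= prefix_sum (indicator R (sampled t)) j.
Proof.
move=> jn h; rewrite !prefix_sampled // addrAC lerD2r -intrD ler_int.
rewrite /level floor_ge_int intrD.
have := floor_le (Z m + t); rewrite /Z; lra.
Qed.

Let frac (z : R) : R := z - (Num.floor z)%:~R.
(** For $t\in[0,1]$ the level at [j] jumps only at $1-\{Z_j\}$. Between consecutive nodes all levels
    are constant, so weights [gap] replace the integral over $t$. *)
Let breaks : seq R := sort <=%R (0 :: [seq 1 - frac (Z j) | j <- iota 0 n.+1]).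
Let gap (i : nat) : R := breaks`_i.+1 - breaks`_i.

Let frac_itv z : 0 <= frac z < 1.
Proof. by have := floor_itv z; rewrite /frac intrD; lra. Qed.

Let breaks_itv c : c \in breaks -> 0 <= c <= 1.
Proof.
rewrite mem_sort inE => /orP[/eqP->|/mapP[j _ ->]]; first by rewrite lexx ler01.
by have := frac_itv (Z j); lra.
Qed.

Let breaks_sorted : sorted <=%R breaks.
Proof. exact/sort_le_sorted. Qed.

Let break_mem j : (j <= n)%N -> 1 - frac (Z j) \in breaks.
Proof.
by move=> jn; rewrite mem_sort inE; apply/orP; right; apply/mapP; exists j; rewrite ?mem_iota.
Qed.

Let size_breaks : size breaks = n.+2.
Proof. by rewrite size_sort /= size_map size_iota. Qed.

Let nth_breaks i : (i < n.+2)%N -> 0 <= breaks`_i <= 1.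
Proof. by move=> h; apply/breaks_itv/mem_nth; rewrite size_breaks. Qed.

Let breaks_mono i j : (i <= j < n.+2)%N -> breaks`_i <= breaks`_j.
Proof.
by move=> /andP[ij js]; apply: le_sorted_leq_nth;
  rewrite ?inE ?size_breaks ?(leq_ltn_trans ij).
Qed.

Let breaks_first : breaks`_0 = 0.
Proof.
have : 0 \in breaks by rewrite mem_sort inE eqxx.
move=> /(nthP 0)[q]; rewrite size_breaks => qs q0.
have := @breaks_mono 0 q; have := @nth_breaks 0; rewrite q0.
move=> h1 h2; have {h1} := h1 isT; have {h2} := h2 qs; lra.
Qed.

Let breaks_last : breaks`_n.+1 = 1.
Proof.
have := break_mem mn; rewrite /Z subrr /frac floor0 !subr0.
move=> /(nthP 0)[q]; rewrite size_breaks => qs q1.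
have := @breaks_mono q n.+1; have := @nth_breaks n.+1; rewrite q1.
move=> h1 h2; have {h1} := h1 (leqnn _); have {h2} := h2 ltac:(lia); lra.
Qed.

Let gap_ge0 (i : 'I_n.+1) : 0 <= gap i.
Proof. by rewrite subr_ge0; apply: breaks_mono; have := ltn_ord i; lia. Qed.

Let sum_gap : \sum_(i < n.+1) gap i = 1.
Proof.
rewrite -(big_mkord xpredT gap) telescope_sumr //.
by rewrite breaks_first breaks_last subr0.
Qed.

(* The average of floor(z + t) over t in [0, 1] is z, and the breakpoints     *)
(* capture every jump of the integrand.                                       *)
Let sum_level (j : nat) : (j <= n)%N ->
  \sum_(i < n.+1) gap i * (level breaks`_i j)%:~R = Z j.
Proof.
move=> jn; under eq_bigr => i _.
  rewrite floorD_frac ?mulrDr; last by apply: nth_breaks; have := ltn_ord i; lia.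
  over.
rewrite big_split /= -mulr_suml sum_gap mul1r.
have := sum_gaps_above breaks_sorted (break_mem jn).
rewrite size_breaks breaks_last => ->; rewrite /frac; lra.
Qed.

Lemma systematic_sampling : exists2 lam, convex_rep x lam &
  forall J, lam J != 0 -> exists t, J = sampled t.
Proof.
(* Different nodes may sample the same set, so the gaps are collected by set. *)
pose lam J : R := \sum_(i < n.+1) gap i * (J == sampled breaks`_i)%:R.
have lam_sum (g : {set 'I_n} -> R) :
    \sum_J lam J * g J = \sum_(i < n.+1) gap i * g (sampled breaks`_i).
  under eq_bigr do rewrite mulr_suml.
  rewrite exchange_big; apply: eq_bigr => i _ /=.
  rewrite (bigD1 (sampled breaks`_i)) //= eqxx mulr1 big1 ?addr0 // => J.
  by move=> /negPf->; rewrite mulr0 mul0r.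
exists lam; first split.
- by move=> J; apply: sumr_ge0 => i _; rewrite mulr_ge0 ?ler0n.
- have := lam_sum (fun=> 1); under eq_bigr do rewrite mulr1.
  by move=> ->; under eq_bigr do rewrite mulr1.
- apply/rowP => a; rewrite summxE.
  under eq_bigr do rewrite !mxE.
  rewrite lam_sum; under eq_bigr do rewrite sampledE mulrBr.
  by rewrite sumrB !sum_level ?(ltnW (ltn_ord a)) // /Z prefix_sumS; lra.
move=> J lamJ; have /existsP[i /eqP e] : [exists i : 'I_n.+1, J == sampled breaks`_i].
  apply: contraNT lamJ => /existsPn H; rewrite /lam big1 // => i _.
  by rewrite (negPf (H i)) mulr0.
by exists breaks`_i.
Qed.

End Rounding.

Section ConcaveExtension.
Variables (R : realType) (n : nat) (I : {set 'I_n}).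

Definition cut_bound (x : 'rV[R]_n) (m : nat) : R :=
  prefix_sum x m + #|I :&: suffix n m|%:R.

Lemma cut_bound_convex (x : 'rV[R]_n) lam m : convex_rep x lam ->
  \sum_J lam J * cut_bound (indicator R J) m = cut_bound x m.
Proof.
move=> [_ lam1 <-]; rewrite /cut_bound.
under eq_bigr do rewrite mulrDr.
rewrite big_split /= -mulr_suml lam1 mul1r; congr (_ + _).
rewrite [RHS]/prefix_sum; under [RHS]eq_bigr do rewrite summxE.
rewrite exchange_big /=; apply: eq_bigr => J _; rewrite mulr_sumr.
by apply: eq_bigr => i _; rewrite [RHS]mxE.
Qed.

Lemma cut_bound_indicator (J : {set 'I_n}) m :
  cut_bound (indicator R J) m = (#|J :&: prefix n m| + #|I :&: suffix n m|)%:R.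
Proof. by rewrite /cut_bound prefix_sum_indicator natrD. Qed.

Lemma concave_ext_cut_bound (x : 'rV[R]_n) m : in_cube x -> (m <= n)%N ->
  (forall j, (j <= n)%N -> cut_bound x m <= cut_bound x j) ->
  concave_ext (schubert_rank I) x (cut_bound x m).
Proof.
move=> xc mn xmin; split; last first.
  move=> lam hlam; rewrite -(cut_bound_convex m hlam).
  have [lam0 _ _] := hlam.
  apply: ler_sum => J _; rewrite ler_wpM2l //.
  by rewrite cut_bound_indicator ler_nat schubert_rank_le.
have [lam hlam supp] := systematic_sampling xc mn; exists lam => //.
rewrite -(cut_bound_convex m hlam); apply: eq_bigr => J _.
have [->|/supp[t ->]] := eqVneq (lam J) 0; first by rewrite !mul0r.
congr (_ * _); apply/eqP; rewrite eq_le; apply/andP; split.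
  by rewrite cut_bound_indicator ler_nat schubert_rank_le.
have [j jn hj] := schubert_rank_ge I (sampled x m t).
apply: le_trans (_ : cut_bound (indicator R (sampled x m t)) j <= _); last first.
  by rewrite cut_bound_indicator ler_nat.
(* With this integer $c$, $F_m\le F_j$ reads $X_m+c\le X_j$, the form that passes from [x] to the
   sampled set. *)
have := @sampled_prefix_ge _ _ x m xc mn t j
  (#|I :&: suffix n m|%:Z - #|I :&: suffix n j|%:Z) jn.
have := xmin j jn; rewrite /cut_bound intrB !pmulrn => h1 h2.
have {h2} := h2 ltac:(lra); lra.
Qed.

End ConcaveExtension.

(** * Cyclic data *)

Ltac add_fact t := let T := type of t in
  lazymatch goal with H : T |- _ => fail | _ => pose proof t end.
(* Translates cyclic distances, successors and predecessors into linear       *)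
(* arithmetic.                                                                *)
Ltac cyclic_lia := try subst;
  repeat match goal with
  | |- context [cdist ?a ?x] => add_fact (cdistP a x)
  | H : context [cdist ?a ?x] |- _ => add_fact (cdistP a x)
  end;
  repeat match goal with
  | |- context [@ordS ?N ?a] => add_fact (ordSP a)
  | H : context [@ordS ?N ?a] |- _ => add_fact (ordSP a)
  | |- context [@ord_pred ?N ?a] => add_fact (ord_predP a)
  | H : context [@ord_pred ?N ?a] |- _ => add_fact (ord_predP a)
  end;
  repeat match goal with
  | H : context [nat_of_ord ?a] |- _ => add_fact (ltn_ord a)
  end;
  repeat match goal with
  | H : is_true (_ \in _) |- _ => clear H
  | H : is_true (_ \notin _) |- _ => clear H
  | H : is_true (_ \subset _) |- _ => clear H
  | H : forall _, _ |- _ => clear H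
  end;
  lia.

(** * Maximal arcs and their endpoints *)

Section Arcs.
Variables (N : nat) (I : {set 'I_N}).
Hypothesis I_proper : I != setT.

Lemma val_neq (a b : 'I_N) : a <> b -> a <> b :> nat.
Proof. by move=> h /val_inj. Qed.

Lemma arc_missing (a e : 'I_N) : cyc_itv a e \subset I ->
  exists b, (cdist a e < cdist a b)%N.
Proof.
move=> sub; have [b bI] : exists b, b \notin I.
  by apply/existsP; rewrite -negb_forall; apply: contra I_proper => /forallP H;
    apply/eqP/setP => i; rewrite inE H.
exists b; rewrite ltnNge; apply: contra bI => h; apply: (subsetP sub).
by rewrite inE.
Qed.

(** An arc determines its endpoints once it is not the whole circle, which [arc_missing] ensures. *)
Lemma max_arc_ends (a e : 'I_N) : max_cyclic_interval I (cyc_itv a e) ->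
  is_first I e a /\ is_end I e.
Proof.
move=> hmax; have [a' [e' [E f' l']]] := max_arc I_proper hmax.
have sub : cyc_itv a e \subset I by rewrite E; case/andP: f'.
have [b hb] := arc_missing sub.
have mem x : (cdist a x <= cdist a e)%N = (cdist a' x <= cdist a' e')%N.
  by have := congr1 (fun B : {set 'I_N} => x \in B) E; rewrite !inE.
have ea : a = a'.
  apply/eqP/negPn/negP => /eqP/val_neq h.
  by have h1 := mem a; have h2 := mem (ord_pred a); cyclic_lia.
rewrite {}ea in mem hb E sub *.
suff -> : e = e' by [].
apply/eqP/negPn/negP => /eqP/val_neq h.
by have h1 := mem e; have h2 := mem e'; cyclic_lia.
Qed.

End Arcs.

Section CyclicData.
Variables (N : nat) (I : {set 'I_N}) (D : block_data N).
Hypotheses (I_proper : I != setT) (hD : is_cyclic_data D I).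

Local Notation fst_ := (blk_first D).
Local Notation lst_ := (blk_last D).
Local Notation s := (sigma D).

Lemma blk_reduce i : exists j, [/\ (1 <= j <= s)%N, i = j %[mod s],
  fst_ i = fst_ j & lst_ i = lst_ j].
Proof.
have s0 := sigma_gt0 hD.
have per j q : fst_ (j + q * s)%N = fst_ j /\ lst_ (j + q * s)%N = lst_ j.
  elim: q => [|q [IH1 IH2]]; first by rewrite addn0.
  rewrite mulSn addnCA addnC; split.
    by rewrite (blk_first_mod hD).
  by rewrite (blk_last_mod hD).
case: i => [|i].
  exists s; split; rewrite ?leqnn ?s0 ?modnn ?mod0n //.
    by rewrite -(blk_first_mod hD).
  by rewrite -(blk_last_mod hD).
exists (i %% s).+1%N; have [h1 h2] := per (i %% s).+1%N (i %/ s)%N.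
have E : i.+1 = ((i %% s).+1 + i %/ s * s)%N by rewrite addSn addnC -divn_eq.
rewrite -{}h1 -{}h2 -E; split=> //; first by rewrite ltn_pmod.
by rewrite -(addn1 (_ %% _)) modnDml addn1.
Qed.

Lemma blk_ends i : is_first I (lst_ i) (fst_ i) /\ is_end I (lst_ i).
Proof.
have [j [hj _ -> ->]] := blk_reduce i.
by apply: max_arc_ends => //; apply/(blk_max hD); exists j.
Qed.

Lemma blkI_sub i : blkI D i \subset I.
Proof. by have [/andP[]] := blk_ends i. Qed.

Lemma ends_blk f : is_end I f -> exists2 i, (1 <= i <= s)%N & lst_ i = f.
Proof.
move=> fe; have /andP[fI Sf] := fe; have [a fa] := exit_bwd fI Sf.
have /(blk_max hD)[i hi E] := arc_max fa fe.
exists i => //; have [h1 h2] := blk_ends i.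
by rewrite (end_uniq fe h2 h1 fa E).
Qed.

Lemma blk_last_inj i j : (1 <= i <= s)%N -> (1 <= j <= s)%N ->
  lst_ i = lst_ j -> i = j.
Proof.
move=> hi hj E; apply: (blk_inj hD) => //.
have [h1 _] := blk_ends i; have [h2 _] := blk_ends j.
by rewrite /blkI -E (first_uniq h1 (_ : is_first I _ (fst_ j))) // E.
Qed.

Lemma blk_last_eqmod i j : lst_ i = lst_ j -> i = j %[mod s].
Proof.
have [i' [hi -> _ ->]] := blk_reduce i; have [j' [hj -> _ ->]] := blk_reduce j.
by move=> /(blk_last_inj hi hj) ->.
Qed.

(** The successor of a block's last element lies outside [I], hence outside the next block, so gap
    and block concatenate to one arc without overlap. *)
Lemma blkSE i : blkS D i.+1 = cyc_itv (ordS (lst_ i)) (lst_ i.+1).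
Proof.
have e : (lst_ (i.+1 + s).-1) = lst_ i by rewrite addSn /= (blk_last_mod hD).
have [/andP[sub _] _] := blk_ends i.+1; have [_ /andP[_ h]] := blk_ends i.
rewrite /blkS /blkC /blkI e.
have {}h : ordS (lst_ i) \notin cyc_itv (fst_ i.+1) (lst_ i.+1).
  by apply: contra h; apply: (subsetP sub).
rewrite inE -ltnNge in h.
move: (ordS (lst_ i)) (fst_ i.+1) (lst_ i.+1) h => t a b h {e sub}.
by apply/setP => z; rewrite !inE; cyclic_lia.
Qed.

Lemma blkS_capI i : I :&: blkS D i = blkI D i.
Proof.
rewrite /blkS setIUr (_ : I :&: blkC D i = set0) ?set0U.
  by apply/setIidPr/blkI_sub.
by apply/eqP; rewrite setIC setI_eq0; apply: (blk_gap hD).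
Qed.

(** An end met earlier would lie in the block itself, and so would its successor, which is not in
    [I]. *)
Lemma blkS_next_end i z f : is_end I f -> z \in blkS D i.+1 ->
  (cdist z (lst_ i.+1) <= cdist z f)%N.
Proof.
move=> /andP[fI Sf]; have cap := blkS_capI i.+1; rewrite !blkSE in cap *.
rewrite inE => hz; rewrite leqNgt; apply/negP => lt.
have : f \in blkI D i.+1.
  by rewrite -cap inE fI inE; cyclic_lia.
rewrite inE => hf; case/negP: Sf; apply: (subsetP (blkI_sub i.+1)).
rewrite inE; move: (lst_ i.+1) (fst_ i.+1) lt hf {hz cap} => e a lt hf.
have h : f <> e :> nat by move=> /val_inj E; rewrite E ltnn in lt.
by cyclic_lia.
Qed.

Lemma blk_last_min i (o : 'I_N) f : o = 0%N :> nat -> o \in blkS D i.+1 ->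
  is_end I f -> (lst_ i.+1 <= f)%N.
Proof. by move=> o0 /(@blkS_next_end i o f) H /H {H}; rewrite !cdistE o0 !subn0. Qed.

Lemma blk_last_first f : is_end I f -> (lst_ 1 <= f)%N.
Proof.
have /existsP[o /andP[oS /eqP[o0]]] := blk_one hD.
exact: (blk_last_min o0 oS).
Qed.

(** Otherwise [blkS D i.+1] wraps through position 0; its end is then the least of all ends, which
    is that of block 1. *)
Lemma blk_last_lt_next i : (1 <= i < s)%N -> (lst_ i < lst_ i.+1)%N.
Proof.
move=> hi; rewrite ltnNge; apply/negP => h.
have [z z0] : exists z : 'I_N, z = 0%N :> nat.
  by have lt := ltn_ord (lst_ 1); exists (Ordinal (leq_ltn_trans (leq0n _) lt)).
have zS : z \in blkS D i.+1.
  rewrite blkSE inE; have nz : lst_ i <> lst_ i.+1 :> nat.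
    by move=> /val_inj /blk_last_inj; lia.
  by cyclic_lia.
have e : lst_ i.+1 = lst_ 1.
  apply: val_inj; apply/eqP; rewrite eqn_leq /=.
  by rewrite (blk_last_min z0 zS) ?blk_last_first //; have [] := blk_ends 1; have [] := blk_ends i.+1.
by have := blk_last_inj _ _ e; lia.
Qed.

Lemma blk_last_lt i j : (1 <= i)%N -> (i < j <= s)%N -> (lst_ i < lst_ j)%N.
Proof.
move=> i0; elim: j => [|j IH] //= hj.
have [->|ij] := eqVneq i j; first by apply: blk_last_lt_next; lia.
by apply: ltn_trans (IH _) (blk_last_lt_next _); lia.
Qed.

(** A strictly increasing list is determined by its members, so the block indexing of two sets can
    be compared through their ends alone. *)
Definition end_seq : seq nat := [seq val (lst_ i.+1) | i <- iota 0 s].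

Lemma end_seq_sorted : sorted ltn end_seq.
Proof.
rewrite sorted_map; apply: (@sub_in_sorted _ (mem (iota 0 s)) ltn).
- move=> i j; rewrite !mem_iota => hi hj ij /=.
  by apply: blk_last_lt => //; rewrite /= in ij; lia.
- by apply/allP => i.
exact: iota_ltn_sorted.
Qed.

Lemma mem_end_seq p :
  reflect (exists2 f : 'I_N, is_end I f & p = f :> nat) (p \in end_seq).
Proof.
apply: (iffP mapP) => [[i _ ->]|[f /ends_blk[i hi <-] ->]].
  by exists (lst_ i.+1) => //; have [] := blk_ends i.+1.
by exists i.-1; rewrite ?mem_iota ?prednK //; lia.
Qed.

Lemma nth_end_seq i : (i < s)%N -> nth 0%N end_seq i = lst_ i.+1.
Proof. by move=> h; rewrite (nth_map 0%N) ?size_iota ?nth_iota. Qed.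

Lemma card_blkI_next i : (1 <= i < s)%N ->
  (#|blkI D i.+1| + #|I :&: suffix N (lst_ i.+1).+1|
    = #|I :&: suffix N (lst_ i).+1|)%N.
Proof.
move=> /blk_last_lt_next lt.
rewrite -(cardsID (blkS D i.+1) (_ :&: suffix _ (lst_ i).+1)); congr (_ + _)%N.
  rewrite -blkS_capI blkSE; apply: eq_card => z; rewrite !inE.
  by case: (z \in I) => //=; cyclic_lia.
rewrite blkSE; apply: eq_card => z; rewrite !inE.
by case: (z \in I) => //=; cyclic_lia.
Qed.

Lemma sum_card_blkI i : (2 <= i <= s.+1)%N ->
  (\sum_(i <= j < s.+1) #|blkI D j| + #|I :&: suffix N (lst_ s).+1|
    = #|I :&: suffix N (lst_ i.-1).+1|)%N.
Proof.
move=> hi; have {hi}[d] : exists d, (i + d = s.+1 /\ 2 <= i)%N.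
  by exists (s.+1 - i)%N; lia.
elim: d i => [|d IH] i [e hi].
  by rewrite (_ : i = s.+1) ?big_geq ?add0n //; lia.
rewrite big_ltn; last by lia.
rewrite -addnA IH /=; last by lia.
have := @card_blkI_next i.-1; rewrite prednK; last by lia.
by apply; lia.
Qed.

(* Blocks wrap around only if both 1 and N lie in I. *)
Lemma suffix_last_end (o m : 'I_N) : o = 0%N :> nat -> m.+1 = N ->
  ~~ ((o \in I) && (m \in I)) -> #|I :&: suffix N (lst_ s).+1| = 0%N.
Proof.
move=> o0 mN h; apply/eqP; rewrite cards_eq0; apply/eqP/setP => f; rewrite !inE.
apply/negbTE/andP => -[fI hf].
have [g ge fg] : exists2 g : 'I_N, is_end I g & (f <= g)%N.
  case: (boolP (m \in I)) h => mI; rewrite ?andbT ?andbF => h.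
    exists m; last by have := ltn_ord f; lia.
    rewrite /is_end mI; suff -> : ordS m = o by [].
    by apply: val_inj; rewrite /= mN modnn.
  have [|g ge hg] := @exit_fwd _ _ o m f fI mI; first by cyclic_lia.
  by exists g => //; rewrite !cdistE o0 !subn0 /= in hg; lia.
have [i hi ei] := ends_blk ge.
have [eis|nis] := eqVneq i s; first by rewrite eis in ei; rewrite ei in hf; lia.
have := @blk_last_lt i s; rewrite ei; lia.
Qed.

End CyclicData.

(** * Padding and cones *)

Lemma blk_last_congr (N : nat) (A : {set 'I_N}) (D : block_data N) i j :
  A != setT -> is_cyclic_data D A -> i = j %[mod sigma D] ->
  blk_last D i = blk_last D j.
Proof.
move=> AT hD ij.
have [i' [hi ei _ ->]] := blk_reduce hD i; have [j' [hj ej _ ->]] := blk_reduce hD j.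
have : i'.-1.+1 = j'.-1.+1 %[mod sigma D] by rewrite !prednK -?ei -?ej //; lia.
rewrite -(addn1 i'.-1) -(addn1 j'.-1) => /eqP; rewrite eqn_modDr !modn_small; try lia.
by move=> /eqP E; congr (blk_last D _); lia.
Qed.

Lemma sum_arc (R : realType) (N : nat) (w : 'I_N -> R) (a b : 'I_N) :
    \sum_i w i = 0 ->
  \sum_(i in cyc_itv (ordS a) b) w i =
    \sum_(i < N | (i <= b)%N) w i - \sum_(i < N | (i <= a)%N) w i.
Proof.
move=> w0.
have mk (P : pred 'I_N) : \sum_(i | P i) w i = \sum_i w i * (P i)%:R.
  by rewrite big_mkcond; apply: eq_bigr => i _; case: (P i); rewrite ?mulr1 ?mulr0.
have z : (\sum_i w i) * (b <= a)%N%:R = 0 by rewrite w0 mul0r.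
rewrite !mk -sumrB -[RHS]addr0 -[X in _ + X]z mulr_suml -big_split /=.
apply: eq_bigr => i _; rewrite inE.
(* The summand [b <= a] is the full turn made by a wrapping arc; it costs nothing because the total
   weight is 0. *)
have e : ((cdist (ordS a) i <= cdist (ordS a) b) + (i <= a) = (i <= b) + (b <= a))%N.
  by cyclic_lia.
have := congr1 (fun m => m%:R : R) e; rewrite !natrD => e'.
by rewrite -mulrBr -mulrDr; congr (_ * _); lra.
Qed.

Lemma coord_sum_blkS (R : realType) (N : nat) (A : {set 'I_N}) (D : block_data N)
    (y : 'rV[R]_N) (W := fun i => \sum_(p < N | (p <= blk_last D i)%N)
      (y 0 p - (p \in A)%:R)) i :
    A != setT -> is_cyclic_data D A -> coord_sum y [set: 'I_N] = #|A|%:R ->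
  coord_sum y (blkS D i.+1) - #|blkI D i.+1|%:R = W i.+1 - W i.
Proof.
move=> AT hD ytot.
have natA (B : {set 'I_N}) : #|A :&: B|%:R = \sum_(p in B) (p \in A)%:R :> R.
  rewrite -natr_sum -sum1_card big_mkcond [in RHS]big_mkcond /=; congr (_%:R).
  by apply: eq_bigr => p _; rewrite inE; case: (p \in A); case: (p \in B).
rewrite -(blkS_capI AT hD) natA /coord_sum -sumrB (blkSE AT hD) sum_arc //.
rewrite sumrB; apply/eqP; rewrite subr_eq0; apply/eqP.
transitivity (coord_sum y [set: 'I_N]); first by apply: eq_bigl => p; rewrite inE.
by rewrite ytot -[in LHS](setIT A) natA; apply: eq_bigl => p; rewrite inE.
Qed.

Lemma blkS_disjoint (N : nat) (A : {set 'I_N}) (D : block_data N) i j :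
    A != setT -> is_cyclic_data D A -> i != j %[mod sigma D] ->
  [disjoint blkS D i.+1 & blkS D j.+1].
Proof.
move=> AT hD; apply: contraR => /pred0Pn[z /andP[/= zi zj]].
have [_ ei] := blk_ends AT hD i.+1; have [_ ej] := blk_ends AT hD j.+1.
have E : blk_last D i.+1 = blk_last D j.+1.
  apply: (@cdist_inj _ z); apply/eqP; rewrite eqn_leq.
  by rewrite (blkS_next_end AT hD ej zi) (blkS_next_end AT hD ei zj).
by have /eqP := blk_last_eqmod AT hD E; rewrite -(addn1 i) -(addn1 j) eqn_modDr.
Qed.

(** The excess over $t+1$ consecutive blocks telescopes to $W_{i+t+1}-W_i$, and $t\le\sigma-2$
    reaches every residue other than $i$. *)
Lemma block_sums_ge (R : realType) (N : nat) (A : {set 'I_N}) (D : block_data N)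
    (y : 'rV[R]_N) (W := fun i => \sum_(p < N | (p <= blk_last D i)%N)
      (y 0 p - (p \in A)%:R)) i :
    A != setT -> is_cyclic_data D A -> coord_sum y [set: 'I_N] = #|A|%:R ->
  (forall t, (t.+2 <= sigma D)%N ->
     (\sum_(s < t.+1) #|blkI D (i.+1 + s)%N|)%:R
       <= coord_sum y (\bigcup_(s < t.+1) blkS D (i.+1 + s)%N)) <->
  (forall j, W i <= W j).
Proof.
move=> AT hD ytot.
have sums t : (t.+2 <= sigma D)%N ->
    coord_sum y (\bigcup_(s < t.+1) blkS D (i.+1 + s)%N)
      - (\sum_(s < t.+1) #|blkI D (i.+1 + s)%N|)%:R = W (i + t.+1)%N - W i.
  move=> ht; rewrite /coord_sum partition_disjoint_bigcup /= => [|a b ab]; last first.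
    rewrite !addSn; apply: blkS_disjoint AT hD _.
    rewrite eqn_modDl !modn_small //; have := ltn_ord a; have := ltn_ord b; lia.
  rewrite natr_sum -sumrB.
  rewrite -(big_mkord xpredT (fun s => coord_sum y (blkS D (i.+1 + s)%N)
    - #|blkI D (i.+1 + s)%N|%:R)).
  have := telescope_sumr (fun s => W (i + s)%N) (leq0n t.+1); rewrite addn0 => <-.
  by apply: eq_bigr => s _; rewrite addSn (coord_sum_blkS _ AT hD ytot) addnS.
split=> [H j|H t ht]; last first.
  by rewrite -subr_ge0 sums // subr_ge0.
have [d] : exists d, (d < sigma D)%N /\ j = i + d %[mod sigma D].
  (* This is $j-i$ modulo $\sigma$, written without subtraction. *)
  exists ((j + i * (sigma D).-1) %% sigma D)%N; have s0 := sigma_gt0 hD.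
  split; first by rewrite ltn_pmod.
  rewrite modnDmr (_ : i + _ = i * sigma D + j)%N ?modnMDl //.
  by rewrite addnCA -mulnS prednK // addnC.
move=> [ds /(blk_last_congr AT hD) e]; rewrite {2}/W e -/(W _).
case: d ds {e} => [|t] ht; first by rewrite addn0.
by rewrite -subr_ge0 -sums // subr_ge0 H.
Qed.

Lemma mem_has_label (N : nat) (A : {set 'I_N}) (f : 'I_N) :
  (f \in A) = has_label A f.+1.
Proof.
apply/idP/existsP => [h|[g /andP[gA /eqP[/val_inj <-]]]] //.
by exists f; rewrite h eqxx.
Qed.

Lemma has_label_range (N : nat) (A : {set 'I_N}) m :
  has_label A m -> (0 < m <= N)%N.
Proof. by move=> /existsP[f /andP[_ /eqP <-]] /=. Qed.

Lemma mem_end_seq_label (N : nat) (A : {set 'I_N}) (D : block_data N) (p : nat) :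
    A != setT -> is_cyclic_data D A ->
  (p \in end_seq D) =
    has_label A p.+1 && ~~ has_label A (if p.+1 == N then 1 else p.+2)%N.
Proof.
move=> AT hD; apply/(mem_end_seq AT hD)/andP.
  move=> [f /andP[fA Sf] ->]; rewrite -mem_has_label; split=> //.
  by move: Sf; rewrite mem_has_label ordSE; case: eqP.
move=> [pA Sp]; have := has_label_range pA => /= pN.
exists (Ordinal pN) => //; rewrite /is_end !mem_has_label ordSE /= pA.
by case: eqP Sp.
Qed.

Section Padding.
Variables (n : nat) (I : {set 'I_n}).

Lemma mem_pad_lshift i : (lshift n i \in pad I) = (i \in I).
Proof.
rewrite inE (mem_imset _ _ (@lshift_inj n n)) orbC.
by case: imsetP => // -[j _ /eqP]; rewrite eq_lrshift.
Qed.

Lemma mem_pad_rshift (j : 'I_n) : (rshift n j \in pad I) = (#|I| <= j)%N.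
Proof.
rewrite inE (mem_imset _ _ (@rshift_inj n n)) inE.
by case: imsetP => // -[i _ /eqP]; rewrite eq_rlshift.
Qed.

Lemma has_label_pad p : has_label (pad I) p.+1 =
  has_label I p.+1 || (n + #|I| <= p < n + n)%N.
Proof.
case: (ltnP p (n + n)) => [pn|np]; last first.
  rewrite andbF orbF; apply/idP/idP => /has_label_range; lia.
have -> : has_label (pad I) p.+1 = (Ordinal pn \in pad I) by rewrite mem_has_label.
rewrite andbT; case: (ltnP p n) => np.
  have -> : Ordinal pn = lshift n (Ordinal np) by apply: val_inj.
  by rewrite mem_pad_lshift mem_has_label orbC; case: leqP => //; lia.
have pn' : (p - n < n)%N by lia.
have -> : Ordinal pn = rshift n (Ordinal pn') by apply: val_inj => /=; lia.
rewrite mem_pad_rshift /=; case: (boolP (has_label I p.+1)) => [/has_label_range|_] /=; lia.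
Qed.

Lemma card_pad_suffix m : (m <= n)%N ->
  #|pad I :&: suffix (n + n) m| = (#|I :&: suffix n m| + (n - #|I|))%N.
Proof.
move=> mn; rewrite -!sum1_card big_split_ord /=; congr (_ + _)%N.
  by apply: eq_bigl => i; rewrite !inE -mem_pad_lshift !inE.
rewrite (eq_bigl (fun j : 'I_n => true && (#|I| <= j)%N)) => [|j].
  by rewrite -(big_geq_mkord _ _ xpredT (fun=> 1%N)) sum_nat_const_nat muln1 sum1_card.
by rewrite inE mem_pad_rshift inE /= (leq_trans mn (leq_addr _ _)) andbT.
Qed.

Hypothesis I_range : (0 < #|I| < n)%N.

Lemma card_pad : #|pad I| = n.
Proof.
by have := @card_pad_suffix 0 (leq0n _); rewrite !suffix0 !setIT => ->; lia.
Qed.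

Lemma proper_neqT : I != setT.
Proof. by apply: contraTneq I_range => ->; rewrite cardsT card_ord; lia. Qed.

Lemma pad_neqT : pad I != setT.
Proof.
apply/eqP => E; have := card_pad; rewrite E cardsT card_ord; lia.
Qed.

Variables (D : block_data n) (Dt : block_data (n + n)).
Hypotheses (hD : is_cyclic_data D I) (hDt : is_cyclic_data Dt (pad I)).

(** The end that padding creates, as a zero-based position. If $1\in I$, the padding runs on into
    the block at 1, and only a block of $I$ joining $n$ to 1 gets cut, at $n$. If $1\notin I$, the
    padding is a block of its own ending at $2n$. *)
Definition extra_end : seq nat :=
  if has_label I 1 then if has_label I n then [:: n.-1] else [::] else [:: (n + n).-1].

Lemma end_seq_pad : end_seq Dt = end_seq D ++ extra_end.
Proof.
have memD (p : nat) := mem_end_seq_label p proper_neqT hD.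
apply: (irr_sorted_eq ltn_trans ltnn).
- exact: (end_seq_sorted pad_neqT hDt).
- rewrite sorted_pairwise; last exact: ltn_trans.
  rewrite pairwise_cat -!(sorted_pairwise ltn_trans).
  rewrite (end_seq_sorted proper_neqT hD) /extra_end /= andbC.
  apply/andP; split; first by case: ifP => // _; case: ifP.
  apply/allrelP => p q; rewrite memD => /andP[/has_label_range pn hp].
  case: (boolP (has_label I 1)) hp => L1; last by rewrite inE; lia.
  case: (has_label I n) => //; rewrite inE => hp /eqP ->.
  by case: eqP hp => [_|ne _]; rewrite ?L1 //; lia.
- move=> p; rewrite mem_cat memD (mem_end_seq_label p pad_neqT hDt) /extra_end.
  have -> : (if p.+1 == n + n then 1 else p.+2)%N
    = (if p.+1 == n + n then 0 else p.+1)%N.+1 by case: eqP.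
  rewrite !has_label_pad.
  have [e|pn] := eqVneq p.+1 n.
    have nk : (n + #|I| <= n)%N = false by lia.
    have pk : (n + #|I| <= p)%N = false by lia.
    rewrite e; have -> : (n == n + n)%N = false by lia.
    rewrite nk pk /=.
    have := @has_label_range _ I n.+1.
    case: (has_label I n.+1) => [/(_ isT)|_]; first by lia.
    by case: (has_label I 1); case: (has_label I n); apply/idP/idP; rewrite ?inE ?in_nil /=; lia.
  have := @has_label_range _ I p.+1; case: (has_label I p.+1) => [/(_ isT) h1|_].
    have e : (p.+1 == n + n)%N = false by lia.
    have pk : (n + #|I| <= p.+1)%N = false by lia.
    rewrite e pk orbF /=; case: (has_label I p.+2) => /=;
    by case: (has_label I 1); case: (has_label I n); rewrite ?inE ?in_nil; lia.
  have [e|ne] := eqVneq p.+1 (n + n)%N; rewrite /=.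
    have -> : (n + #|I| <= p < n + n)%N by lia.
    have -> : (n + #|I| <= 0)%N = false by lia.
    by case: (has_label I 1); case: (has_label I n); rewrite ?inE ?in_nil; lia.
  have -> : (n + #|I| <= p < n + n)%N &&
    ~~ (has_label I p.+2 || (n + #|I| <= p.+1 < n + n)%N) = false.
    by rewrite negb_or; apply/negP => /and3P[/andP[h1 h2] _]; rewrite ltn_neqAle; lia.
  by case: (has_label I 1); case: (has_label I n); rewrite ?inE ?in_nil; lia.
Qed.

Lemma sigma_pad : sigma Dt = (sigma D + size extra_end)%N.
Proof. by have := congr1 size end_seq_pad; rewrite size_cat !size_map !size_iota. Qed.

Lemma blk_last_pad i : (1 <= i <= sigma D)%N -> blk_last Dt i = blk_last D i :> nat.
Proof.
move=> hi; have := congr1 (fun q => nth 0%N q i.-1) end_seq_pad.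
rewrite nth_cat size_map size_iota ifT; last by lia.
by rewrite !nth_end_seq ?prednK // ?sigma_pad; lia.
Qed.

Lemma blk_last_extra : (0 < size extra_end)%N ->
  blk_last Dt (sigma D).+1 = nth 0%N extra_end 0 :> nat.
Proof.
move=> h; have := congr1 (fun q => nth 0%N q (sigma D)) end_seq_pad.
rewrite nth_cat size_map size_iota ltnn subnn => <-.
by rewrite nth_end_seq // sigma_pad; lia.
Qed.

(* Cutting after the last position of [2n] is the same as cutting before the  *)
(* first one, since the total over [2n] vanishes.                             *)
Definition cut (f : 'I_(n + n)) : nat := if (f < n)%N then f.+1 else 0.

Lemma end_pad_range f : is_end (pad I) f -> (f < n)%N || (f == (n + n).-1 :> nat).
Proof.
move=> fe; have : (f : nat) \in end_seq Dt by apply/(mem_end_seq pad_neqT hDt); exists f.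
rewrite end_seq_pad mem_cat => /orP[/(mem_end_seq proper_neqT hD)[g _ ->]|].
  by rewrite ltn_ord.
rewrite /extra_end; case: ifP => _; last by rewrite inE orbC => ->.
by case: ifP => // _; rewrite inE; lia.
Qed.

Variable R : realType.
Implicit Types (x : 'rV[R]_n) (y : 'rV[R]_(n + n)).

(** For [f] below [n], counting $I$ after [f] instead of subtracting $I$ up to [f] shifts by $|I|$;
    at position $2n$ both sides vanish. *)
Lemma pad_prefix_sum y f : coord_sum y [set: 'I_(n + n)] = n%:R ->
    is_end (pad I) f ->
  \sum_(p < n + n | (p <= f)%N) (y 0 p - (p \in pad I)%:R) =
    cut_bound I (lsubmx y) (cut f) - #|I|%:R.
Proof.
move=> ytot /end_pad_range; rewrite /cut; case: ltnP => /= fn.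
  move=> _; rewrite big_split_ord /= [X in _ + X]big_pred0 ?addr0 => [|j]; last by lia.
  rewrite sumrB /cut_bound -(card_prefix_suffix f.+1 I) natrD.
  have -> : \sum_(i < n | (i <= f)%N) (lshift n i \in pad I)%:R
      = #|I :&: prefix n f.+1|%:R :> R.
    rewrite -natr_sum -sum1_card big_mkcond [in RHS]big_mkcond /=; congr (_%:R).
    by apply: eq_bigr => i _; rewrite mem_pad_lshift !inE ltnS; case: (i \in I); case: leqP.
  rewrite /prefix_sum (eq_bigr (fun i => lsubmx y 0 i)) => [|i _]; last by rewrite mxE.
  by rewrite opprD addrACA subrr addr0.
move=> /eqP fe; rewrite (eq_bigl xpredT) => [|p]; last by have := ltn_ord p; lia.
rewrite sumrB /cut_bound prefix_sum0 add0r.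
rewrite suffix0 setIT subrr.
apply/eqP; rewrite subr_eq0; apply/eqP.
transitivity (n%:R : R); first by rewrite -ytot; apply: eq_bigl => p; rewrite inE.
by rewrite -[in LHS]card_pad -natr_sum -sum1_card big_mkcond.
Qed.

Lemma proj_coneP x i : proj_cone Dt i.+1 x <->
  forall j, cut_bound I x (cut (blk_last Dt i)) <= cut_bound I x (cut (blk_last Dt j)).
Proof.
have ends j : is_end (pad I) (blk_last Dt j) by have [] := blk_ends pad_neqT hDt j.
have key y : coord_sum y [set: 'I_(n + n)] = n%:R -> cone Dt i.+1 y <->
    forall j, cut_bound I (lsubmx y) (cut (blk_last Dt i))
      <= cut_bound I (lsubmx y) (cut (blk_last Dt j)).
  move=> ytot; have := ytot; rewrite -[in X in _ = X -> _]card_pad => ytot'.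
  have := block_sums_ge i pad_neqT hDt ytot'.
  move=> H; split=> [[_ /H {}H] j|{}H'].
    by have := H j; rewrite !pad_prefix_sum // lerD2r.
  by split=> //; apply/H => j; rewrite !pad_prefix_sum // lerD2r.
split=> [[y cy <-]|H]; first by apply/key => //; case: cy.
(* Only the total of the last $n$ coordinates matters, so the missing amount is spread equally over
   them. *)
pose c : R := (n%:R - coord_sum x setT) / n%:R.
exists (row_mx x (const_mx c)); last exact: row_mxKl.
apply/key; rewrite ?row_mxKl //.
rewrite /coord_sum (eq_bigl xpredT) => [|p]; last by rewrite inE.
rewrite big_split_ord /=; under [X in _ + X]eq_bigr do rewrite row_mxEr mxE.
under eq_bigr do rewrite row_mxEl.
rewrite sumr_const card_ord -[c *+ n]mulr_natr /c divfK; last by rewrite pnatr_eq0; lia.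
rewrite /coord_sum [X in _ - X](eq_bigl xpredT) => [|p]; last by rewrite inE.
by rewrite addrC subrK.
Qed.

Lemma cut_boundS x (i : 'I_n) :
  cut_bound I x i.+1 = cut_bound I x i + x 0 i - (i \in I)%:R.
Proof.
rewrite /cut_bound prefix_sumS.
have -> : #|I :&: suffix n i| = ((i \in I) + #|I :&: suffix n i.+1|)%N.
  rewrite -(cardsID [set i] (_ :&: suffix n i)); congr (_ + _)%N.
    rewrite (_ : _ :&: [set i] = if i \in I then [set i] else set0).
      by case: ifP; rewrite ?cards1 ?cards0.
    apply/setP => j; rewrite !inE; case: eqP => [->|ne].
      by rewrite leqnn andbT; case: ifP; rewrite ?inE ?eqxx.
    by rewrite andbF; case: ifP; rewrite ?inE //; case: eqP ne.
  by apply: eq_card => j; rewrite !inE ltn_neqAle -val_eqE /= eq_sym andbCA.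
by rewrite natrD; lra.
Qed.

(* The cut bounds decrease along I and increase off I. *)
Lemma cut_bound_min x p : in_cube x -> (p <= n)%N ->
  exists j, cut_bound I x (cut (blk_last Dt j)) <= cut_bound I x p.
Proof.
move=> xc.
have at_end q : q \in end_seq Dt -> exists j, blk_last Dt j = q :> nat.
  by move=> /mapP[j _ ->]; exists j.+1.
(* Walk forward through $I$ until it stops, at the latest at $n$, since $n+1$ is not in
   $\mathbf{pad}(I)$. *)
have fwd (f : 'I_n) : f \in I ->
    exists j, cut_bound I x (cut (blk_last Dt j)) <= cut_bound I x f.+1.
  have [d] : exists d, (f + d.+1 = n)%N by exists (n - f.+1)%N; have := ltn_ord f; lia.
  elim: d f => [|d IH] f fd fI; last first.
    have fn : (f.+1 < n)%N by lia.
    case: (boolP (Ordinal fn \in I)) => SfI.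
      have [|j hj] := IH (Ordinal fn) _ SfI; first by rewrite /=; lia.
      exists j; apply: le_trans hj _; rewrite (cut_boundS _ (Ordinal fn)) SfI /=.
      by have := xc (Ordinal fn); lra.
    have [|j ej] := at_end f.
      rewrite (mem_end_seq_label f pad_neqT hDt).
      have -> : (f.+1 == n + n)%N = false by lia.
      rewrite !has_label_pad -mem_has_label fI /= negb_or.
      by rewrite -(mem_has_label I (Ordinal fn)) SfI /=; lia.
    by exists j; rewrite /cut ej ltn_ord.
  have [|j ej] := at_end f; last by exists j; rewrite /cut ej ltn_ord.
  rewrite (mem_end_seq_label f pad_neqT hDt).
  have -> : (f.+1 == n + n)%N = false by lia.
  have nk : (n + #|I| <= f.+1)%N = false by lia.
  rewrite !has_label_pad -mem_has_label fI nk /= orbF.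
  by apply/negP => /has_label_range; lia.
elim: p => [|p IH] pn.
  have n0 : (0 < n)%N by lia.
  case: (boolP (Ordinal n0 \in I)) => h0.
    have [j hj] := fwd _ h0; exists j; apply: le_trans hj _.
    by rewrite (cut_boundS _ (Ordinal n0)) h0 /=; have := xc (Ordinal n0); lra.
  (* If $1\notin I$, then $2n$ is an end, and its cut is 0. *)
  have [|j ej] := at_end (n + n).-1.
    rewrite end_seq_pad mem_cat /extra_end -(mem_has_label I (Ordinal n0)).
    by rewrite (negPf h0) mem_seq1 eqxx orbT.
  by exists j; rewrite /cut ej; case: ltnP => //; lia.
case: (boolP (Ordinal pn \in I)) => hp; first exact: (fwd _ hp).
have [j hj] := IH (ltnW pn); exists j; apply: le_trans hj _.
by rewrite (cut_boundS _ (Ordinal pn)) (negPf hp) /=; have := xc (Ordinal pn); lra.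
Qed.

Lemma concave_ext_cone x i : proj_cone Dt i.+1 x -> in_cube x ->
  concave_ext (schubert_rank I) x (cut_bound I x (cut (blk_last Dt i))).
Proof.
move=> /proj_coneP H xc; apply: concave_ext_cut_bound => // [|p pn].
  by rewrite /cut; case: ifP.
by have [j hj] := cut_bound_min xc pn; apply: le_trans hj; apply: H.
Qed.

Lemma proj_cone_cover x : in_cube x ->
  exists2 i, (1 <= i <= sigma Dt)%N & proj_cone Dt i x.
Proof.
move=> xc; have s0 := sigma_gt0 hDt.
pose F j := cut_bound I x (cut (blk_last Dt j)).
have [i _ imin] := @arg_minP _ _ _ (Ordinal s0) xpredT
  (fun j : 'I_(sigma Dt) => F j) isT.
exists i.+1; first by rewrite /= ltn_ord.
apply/proj_coneP => j; have js : (j %% sigma Dt < sigma Dt)%N by rewrite ltn_pmod.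
have := imin (Ordinal js) isT; rewrite /F /=.
by rewrite (blk_last_congr pad_neqT hDt (modn_mod j _)).
Qed.

End Padding.

Theorem theorem2p25 (R : realType) (n k : nat) (I : {set 'I_n})
    (D : block_data n) (Dt : block_data (n + n))
    (hk : (1 <= k <= n - 1)%N) (hI : #|I| = k)
    (hD : is_cyclic_data D I) (hDt : is_cyclic_data Dt (pad I)) :
  let l := sigma D in
  let theta_hat_is (x : 'rV[R]_n) (v : R) := concave_ext (schubert_rank I) x v in
  let on_cone (i : nat) (P : 'rV[R]_n -> Prop) :=
    forall x : 'rV[R]_n, proj_cone Dt i x -> in_cube x -> P x in
  (* the two cases are exhaustive and described by 1, n as stated *)
  [/\ sigma Dt = l \/ sigma Dt = l.+1,
      sigma Dt = l <-> has_label I 1 /\ ~~ has_label I n,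
  (* the pieces of the formula cover the cube *)
      forall x : 'rV[R]_n, in_cube x ->
        exists2 i, (1 <= i <= sigma Dt)%N & proj_cone Dt i x,
  (* (1) *)
      sigma Dt = l ->
        (forall i, (2 <= i <= l)%N -> on_cone i (fun x =>
           theta_hat_is x (prefix_sum x (endS D i.-1)
             + (\sum_(i <= j < l.+1) #|blkI D j|)%:R))) /\
        on_cone 1%N (fun x => theta_hat_is x (prefix_sum x (endS D l)))
  (* (2) *)
    & sigma Dt = l.+1 ->
      [/\ (* (a) *)
          has_label I 1 -> has_label I n ->
            (forall i, (2 <= i <= l.+1)%N -> on_cone i (fun x =>
               theta_hat_is x (prefix_sum x (endS D i.-1)
                 + (\sum_(i <= j < l.+1) #|blkI D j|)%:R
                 + #|blkI Dt l.+1|%:R))) /\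
            on_cone 1%N (fun x => theta_hat_is x (prefix_sum x n)),
          (* (b) *)
          ~~ has_label I 1 -> has_label I n ->
            (forall i, (2 <= i <= l.+1)%N -> on_cone i (fun x =>
               theta_hat_is x (prefix_sum x (endS D i.-1)
                 + #|blkI D 1 :\: [set m : 'I_n | (m.+1 <= endS D 1)%N]|%:R
                 + (\sum_(i <= j < l.+1) #|blkI D j|)%:R))) /\
            on_cone 1%N (fun x => theta_hat_is x k%:R)
        & (* (c) *)
          ~~ has_label I 1 -> ~~ has_label I n ->
            (forall i, (2 <= i <= l.+1)%N -> on_cone i (fun x =>
               theta_hat_is x (prefix_sum x (endS D i.-1)
                 + (\sum_(i <= j < l.+1) #|blkI D j|)%:R))) /\
            on_cone 1%N (fun x => theta_hat_is x k%:R)]].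
Proof.
move=> l theta_hat_is on_cone.
have Ir : (0 < #|I| < n)%N by lia.
have IT := proper_neqT Ir.
have l0 : (0 < l)%N := sigma_gt0 hD.
have sz : sigma Dt = (l + size (extra_end I))%N := sigma_pad Ir hD hDt.
have n0 : (0 < n)%N by lia.
have n1 : (n.-1 < n)%N by lia.
have last0 : ~~ (has_label I 1 && has_label I n) ->
    #|I :&: suffix n (blk_last D l).+1| = 0%N.
  move=> h; apply: (@suffix_last_end _ _ _ IT hD (Ordinal n0) (Ordinal n1)) => //=.
    by rewrite prednK.
  by rewrite !mem_has_label /= prednK.
have sums i : (2 <= i <= l.+1)%N ->
  (\sum_(i <= j < l.+1) #|blkI D j| + #|I :&: suffix n (blk_last D l).+1|
    = #|I :&: suffix n (endS D i.-1)|)%N := @sum_card_blkI _ _ _ IT hD i.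
have later i x : (2 <= i <= l.+1)%N -> proj_cone Dt i x -> in_cube x ->
    theta_hat_is x (prefix_sum x (endS D i.-1)
      + #|I :&: suffix n (endS D i.-1)|%:R).
  move=> hi cx; have {cx} : proj_cone Dt i.-1.+1 x by rewrite prednK //; lia.
  move=> /(concave_ext_cone Ir hD hDt) H /H {H}.
  have -> // : cut (blk_last Dt i.-1) = endS D i.-1.
  by rewrite /cut (blk_last_pad Ir hD hDt) ?ltn_ord //; lia.
have first x : proj_cone Dt 1 x -> in_cube x ->
    theta_hat_is x (cut_bound I x (cut (blk_last Dt (sigma Dt)))).
  move=> /(concave_ext_cone Ir hD hDt) H /H {H}.
  (* The block before the first is, cyclically, the last one. *)
  by rewrite -(blk_last_mod hDt 0).
have bound0 (x : 'rV[R]_n) : cut_bound I x 0 = k%:R.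
  by rewrite /cut_bound prefix_sum0 add0r suffix0 setIT hI.
have bound_n (x : 'rV[R]_n) : cut_bound I x n = prefix_sum x n.
  by rewrite /cut_bound suffix_out // setI0 cards0 addr0.
have extra := blk_last_extra Ir hD hDt.
split.
- by rewrite sz /extra_end; case: ifP => _; [case: ifP => _|] => /=; lia.
- rewrite sz /extra_end; case: (has_label I 1) => /=; last by split=> [|[]]; lia.
  by case: (has_label I n) => /=; split=> [|[]]; lia.
- by move=> x; apply: (proj_cone_cover Ir hD hDt).
- move=> e.
  have {}last0 : #|I :&: suffix n (blk_last D l).+1| = 0%N.
    apply: last0; move: sz; rewrite e /extra_end.
    by case: (has_label I 1) => //; case: (has_label I n) => //=; lia.
  split=> [i hi x cx xc|x cx xc].
    have {}hi : (2 <= i <= l.+1)%N by lia.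
    by have := sums i hi; rewrite last0 addn0 => ->; apply: later.
  have := first x cx xc; rewrite e /cut (blk_last_pad Ir hD hDt) ?ltn_ord; last by lia.
  by rewrite /cut_bound last0 addr0.
move=> e; have sz1 : size (extra_end I) = 1%N by lia.
have := extra; rewrite sz1 => /(_ isT); rewrite -/l => {}extra.
split.
- move=> L1 Ln; rewrite /extra_end L1 Ln /= in extra.
  (* Block $l+1$ of $\mathbf{pad}(I)$ ends at $n$ and holds the elements of $I$ after $E(S_l)$. *)
  have last_card : #|I :&: suffix n (blk_last D l).+1| = #|blkI Dt l.+1|.
    have := @card_blkI_next _ _ _ (pad_neqT Ir) hDt l; rewrite e extra prednK //.
    rewrite !card_pad_suffix ?(blk_last_pad Ir hD hDt) ?leqnn ?l0 //.
    by rewrite suffix_out // setI0 cards0 => /(_ isT); lia.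
  split=> [i hi x cx xc|x cx xc].
    by rewrite -addrA -natrD -last_card sums //; apply: later.
  have := first x cx xc; rewrite e /cut extra n1 prednK //.
  by rewrite bound_n.
- move=> L1 Ln; rewrite /extra_end (negPf L1) /= in extra.
  have {}last0 : #|I :&: suffix n (blk_last D l).+1| = 0%N.
    by apply: last0; rewrite (negPf L1).
  (* An element of $I_1$ past $E(S_1)$ would force $I_1$ to wrap through 1, which is not in $I$. *)
  have wrap0 : blkI D 1 :\: [set m : 'I_n | (m.+1 <= endS D 1)%N] = set0.
    apply/setP => z; rewrite [in RHS]inE; apply/negbTE; apply: contra L1.
    rewrite !inE /endS ltnS => /andP[z1 z2].
    rewrite -(mem_has_label I (Ordinal n0)); apply: (subsetP (blkI_sub IT hD 1)).
    have o0 : Ordinal n0 = 0%N :> nat by [].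
    by move: (Ordinal n0) o0 => o o0; rewrite inE; cyclic_lia.
  split=> [i hi x cx xc|x cx xc].
    rewrite wrap0 cards0 addr0.
    by have := sums i hi; rewrite last0 addn0 => ->; apply: later.
  have := first x cx xc; rewrite e /cut extra (_ : (_ < n)%N = false) ?bound0 //; lia.
- move=> L1 Ln; rewrite /extra_end (negPf L1) /= in extra.
  have {}last0 : #|I :&: suffix n (blk_last D l).+1| = 0%N.
    by apply: last0; rewrite (negPf L1).
  split=> [i hi x cx xc|x cx xc].
    by have := sums i hi; rewrite last0 addn0 => ->; apply: later.
  have := first x cx xc; rewrite e /cut extra (_ : (_ < n)%N = false) ?bound0 //; lia.
Qed.
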